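(* Let $\Gamma=\{X_n\}_{n\in\mathbb N_0}$ be a ranking supermartingale with corresponding constant $\epsilon\in(0,\infty)$. Then for all positive integers $k$, $$\mathbb P(Z_\Gamma\ge k)\le\frac{\mathbb E(Z_\Gamma)}{k}\le\frac{\mathbb E(X_0)}{\epsilon\cdot k}.$$
   Context: All random variables live on a probability space $(\Omega,\mathcal F,\mathbb P)$; $\mathbb N_0$ is the set of nonnegative integers. A process $\{X_n\}_{n\in\mathbb N_0}$ adapted to a filtration $\{\mathcal F_n\}_{n\in\mathbb N_0}$ is a ranking supermartingale with constant $\epsilon\in(0,\infty)$ if for all $n\in\mathbb N_0$: $\mathbb E(|X_n|)<\infty$; $X_n\ge0$ a.s.; and $\mathbb E(X_{n+1}\mid\mathcal F_n)\le X_n-\epsilon\cdot\mathbf 1_{X_n>0}$ a.s. The stopping time $Z_\Gamma$ is $Z_\Gamma(\omega):=\min\{n\in\mathbb N_0: X_n(\omega)\le0\}$, with $\min\emptyset:=\infty$. *)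

(* Defs.v *)
From HB Require Import structures.
From mathcomp Require Import all_boot all_order all_algebra.
From mathcomp Require Import all_classical all_reals all_analysis.
Set Implicit Arguments.
Unset Strict Implicit.
Unset Printing Implicit Defensive.
Import Order.TTheory GRing.Theory Num.Theory.
Local Open Scope classical_set_scope.
Local Open Scope ring_scope.

Definition is_filtration (d : measure_display) (T : measurableType d)
    (F : nat -> set (set T)) : Prop :=
  [/\ forall n, sigma_algebra setT (F n),
      forall n, F n `<=` measurable
    & forall m n, (m <= n)%N -> F m `<=` F n].

(* When G is a sigma-algebra, the measurable sets of g_sigma_algebraType G are
   exactly the elements of G, so this is G-measurability of f. *)
Definition measurable_wrt (d : measure_display) (T : measurableType d)
    (R : realType) (G : set (set T)) (f : T -> R) : Prop :=
  measurable_fun [set: g_sigma_algebraType G] (f : g_sigma_algebraType G -> R).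

Definition adapted (d : measure_display) (T : measurableType d) (R : realType)
    (P : probability T R) (F : nat -> set (set T)) (X : nat -> {RV P >-> R})
    : Prop :=
  forall n, measurable_wrt (F n) (X n).

(* Y is a version of E(X | G). *)
Definition is_cond_expectation (d : measure_display) (T : measurableType d)
    (R : realType) (P : probability T R) (G : set (set T)) (X Y : T -> R)
    : Prop :=
  [/\ measurable_wrt G Y,
      P.-integrable setT (EFin \o Y)
    & forall A, G A -> (\int[P]_(w in A) (Y w)%:E = \int[P]_(w in A) (X w)%:E)%E].

(* The inequality on E(X_(n+1) | F_n) is stated for one of its versions; since
   versions agree almost surely, it then holds for all of them. *)
Definition ranking_supermartingale (d : measure_display) (T : measurableType d)
    (R : realType) (P : probability T R) (F : nat -> set (set T))
    (X : nat -> {RV P >-> R}) (epsilon : R) : Prop :=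
  [/\ is_filtration F,
      adapted F X
    & forall n,
      [/\ P.-integrable setT (EFin \o X n),
          {ae P, forall w, 0 <= X n w}
        & exists2 Y : T -> R, is_cond_expectation P (F n) (X n.+1) Y &
            {ae P, forall w,
              Y w <= X n w - epsilon * \1_[set v | 0 < X n v] w}]].

Definition termination_time (d : measure_display) (T : measurableType d)
    (R : realType) (P : probability T R) (X : nat -> {RV P >-> R}) (w : T)
    : \bar R :=
  match pselect (exists n, X n w <= 0) with
  | left hits => ((ex_minn hits)%:R)%:E
  | right _ => +oo%E
  end.

(* Main.v *)
(* The termination time counts the steps at which the process has not yet hit
   zero: Z = \sum_n 1_(A_n) with A_n := {X_0 > 0, ..., X_n > 0}, an event of F_n.
   Integrating the ranking inequality over A_n, and using A_(n+1) <= A_n with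
   X_(n+1) >= 0 a.s., gives
     epsilon P(A_n) + E(X_(n+1); A_(n+1)) <= E(X_n; A_n),
   which telescopes to epsilon E(Z) <= E(X_0). The tail bound is Markov's
   inequality. *)
Require Import Defs.
From mathcomp Require Import all_boot all_order all_algebra.
From mathcomp Require Import all_classical all_reals all_analysis.
From mathcomp Require Import measurable_realfun.
Import Order.TTheory GRing.Theory Num.Theory.
Local Open Scope classical_set_scope.
Local Open Scope ring_scope.
Local Open Scope ereal_scope.

(** Almost everywhere, [f <= g] gives [f^\+ <= g^\+] and [g^\- <= f^\-]; the two comparisons of
    nonnegative integrals are then subtracted. *)
Lemma ae_le_integral (d : measure_display) (T : measurableType d)
    (R : realType) (mu : {measure set T -> \bar R}) (D : set T)
    (f g : T -> \bar R) :
  measurable D -> mu.-integrable D f -> mu.-integrable D g ->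
  {ae mu, forall x, D x -> f x <= g x} ->
  \int[mu]_(x in D) f x <= \int[mu]_(x in D) g x.
Proof.
move=> mD /measurable_int mf /measurable_int mg fg.
rewrite integralE [leRHS]integralE leeB//.
- apply: ae_ge0_le_integral => //; [exact: measurable_funepos..|].
  apply: filterS fg => x + Dx => /(_ Dx) fgx.
  by rewrite !funeposE ge_max !le_max fgx lexx orbT.
- apply: ae_ge0_le_integral => //; [exact: measurable_funeneg..|].
  apply: filterS fg => x + Dx => /(_ Dx) fgx.
  by rewrite !funenegE ge_max !le_max leeN2 fgx lexx orbT.
Qed.

(** [f] agrees almost everywhere with [f^\+], which is nonnegative everywhere, so monotonicity in
    the domain carries over. *)
Lemma ae_ge0_subset_integral (d : measure_display) (T : measurableType d)
    (R : realType) (mu : {measure set T -> \bar R}) (A B : set T)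
    (f : T -> \bar R) :
  measurable A -> measurable B -> measurable_fun B f ->
  {ae mu, forall x, 0 <= f x} -> A `<=` B ->
  \int[mu]_(x in A) f x <= \int[mu]_(x in B) f x.
Proof.
move=> mA mB mf f0 AB.
have mfA : measurable_fun A f by exact: measurable_funS mf.
have fpos D : ae_eq mu D f f^\+.
  by apply: filterS f0 => x fx0 _; rewrite !funeposE max_l.
rewrite (ae_eq_integral f^\+ f)//; last exact: measurable_funepos.
rewrite [leRHS](ae_eq_integral f^\+ f)//; last exact: measurable_funepos.
by apply: ge0_subset_integral => //; exact: measurable_funepos.
Qed.

(** The event that the termination time exceeds [n]. All times up to [n] are required because a path
    may become positive again after hitting zero. *)
Definition alive {T : Type} {R : realType} (X : nat -> T -> R) (n : nat) :
  set T := [set w | forall j, (j <= n)%N -> (0 < X j w)%R].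

Lemma aliveS {T : Type} {R : realType} (X : nat -> T -> R) (n : nat) :
  alive X n.+1 = alive X n `&` [set w | (0 < X n.+1 w)%R].
Proof.
apply/seteqP; split => w /= => [aw|[aw Xw] j].
  by split => [j jn|]; apply: aw => //; exact: leqW.
by rewrite leq_eqVlt => /predU1P[->//|]; exact: aw.
Qed.

Lemma alive0 {T : Type} {R : realType} (X : nat -> T -> R) :
  alive X 0 = [set w | (0 < X 0%N w)%R].
Proof.
apply/seteqP; split => w /= => [aw|Xw j]; first exact: aw.
by rewrite leqn0 => /eqP ->.
Qed.

(** This makes [alive X n] a legitimate test set for the conditional expectation given [F n]. By
    induction, the earlier event is in [F n.+1] by monotonicity of the filtration, and is cut with
    [X n.+1 > 0]. *)
Lemma alive_filtration (d : measure_display) (T : measurableType d)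
    (R : realType) (P : probability T R) (F : nat -> set (set T))
    (X : nat -> {RV P >-> R}) (n : nat) :
  is_filtration F -> adapted F X -> F n (alive X n).
Proof.
move=> [sF _ Fle] adX.
have Xpos m : F m [set w | (0 < X m w)%R].
  have := adX m measurableT `]0%R, +oo[%classic (measurable_itv _).
  rewrite setTI /measurable/= sigma_algebra_id//.
  by congr (F m _); apply/seteqP; split => w /=; rewrite in_itv/= andbT.
elim: n => [|n IH]; first by rewrite alive0; exact: Xpos.
rewrite aliveS -(sigma_algebra_id (sF n.+1)).
apply: (@measurableI _ (g_sigma_algebraType (F n.+1)));
  rewrite /measurable/= sigma_algebra_id//.
exact: Fle IH.
Qed.

Lemma termination_time_series (d : measure_display) (T : measurableType d)
    (R : realType) (P : probability T R) (X : nat -> {RV P >-> R}) (w : T) :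
  termination_time X w = \sum_(0 <= n <oo) (\1_(alive X n) w)%:E.
Proof.
have ge0 n : (0 <= n)%N -> 0 <= (\1_(alive X n) w : R)%:E by rewrite lee_fin.
rewrite /termination_time; case: pselect => [hits|nohit].
  case: ex_minnP => m Xm mmin.
  (* With first hit [m], the indicators are 1 at the [m] indices below [m] and 0 from [m] on. *)
  rewrite (nneseries_split 0 m)// add0n eseries0 ?adde0 => [|i mi _]; last first.
    rewrite indicE memNset// => /(_ m mi).
    by rewrite ltNge Xm.
  rewrite (eq_big_nat _ _ (F2 := fun=> 1%:E)) => [|i /andP[_ im]].
    by rewrite sumEFin big_const_nat subn0 iter_addr addr0.
  rewrite indicE mem_set// => j ji; rewrite ltNge.
  by apply/negP => /mmin; rewrite leqNgt (leq_ltn_trans ji im).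
(* Without a hit every indicator is 1, so a partial sum with more than [r] terms exceeds any given
   [r]. *)
apply/esym/eqyP => r r0.
apply: le_trans (nneseries_lim_ge (Num.Def.truncn r).+1 _) => //.
rewrite (eq_big_nat _ _ (F2 := fun=> 1%:E)) => [|i _].
  rewrite sumEFin big_const_nat subn0 iter_addr addr0 lee_fin.
  exact/ltW/truncnS_gt.
rewrite indicE mem_set// => j _; rewrite ltNge.
by apply/negP => Xj; apply: nohit; exists j.
Qed.

Theorem theorem4 (d : measure_display) (T : measurableType d) (R : realType)
    (P : probability T R) (F : nat -> set (set T)) (X : nat -> {RV P >-> R})
    (epsilon : R) (epsilon_gt0 : (0 < epsilon)%R)
    (X_rsm : ranking_supermartingale F X epsilon)
    (k : nat) (k_gt0 : (0 < k)%N) :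
  P [set w | k%:R%:E <= termination_time X w]
    <= (\int[P]_w termination_time X w) / k%:R%:E /\
  (\int[P]_w termination_time X w) / k%:R%:E
    <= 'E_P[X 0%N] / (epsilon * k%:R)%:E.
Proof.
case: X_rsm => filtF adX step.
have FA n : F n (alive X n) by exact: alive_filtration.
have mA n : measurable (alive X n) by case: (filtF) => _ + _; exact.
have m1 n : measurable_fun setT (fun w => (\1_(alive X n) w : R)%:E).
  exact/measurable_EFinP.
have timeE : termination_time X = fun w => \sum_(0 <= n <oo) (\1_(alive X n) w)%:E.
  by apply/funext => w; exact: termination_time_series.
have mtime : measurable_fun setT (termination_time X).
  by rewrite timeE; apply: ge0_emeasurable_sum.
have time_ge0 w : 0 <= termination_time X w.
  by rewrite timeE; apply: nneseries_ge0 => n _ _; rewrite lee_fin.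
have k0 : (0 < k%:R :> R)%R by rewrite ltr0n.
have intX n D : measurable D -> P.-integrable D (EFin \o X n).
  by move=> mD; apply: integrableS (measurableT) mD _ _ => //; case: (step n).
have descent n : epsilon%:E * P (alive X n)
      + \int[P]_(w in alive X n.+1) (X n.+1 w)%:E
    <= \int[P]_(w in alive X n) (X n w)%:E.
  have [_ _ [Y [_ intY YE] Yle]] := step n.
  have X'0 : {ae P, forall w, 0 <= (X n.+1 w)%:E}.
    by case: (step n.+1) => _ + _; apply: filterS => w; rewrite lee_fin.
  rewrite -leeBrDl; last first.
    by rewrite fin_numM// fin_num_measure.
  have intc : P.-integrable (alive X n) (cst epsilon%:E).
    exact/finite_measure_integrable_cst.
  (* Enlarging the domain from [alive X n.+1] to [alive X n] costs nothing, as [X n.+1 >= 0] a.s. *)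
  apply: (@le_trans _ _ (\int[P]_(w in alive X n) (X n.+1 w)%:E)).
    apply: ae_ge0_subset_integral => //.
      exact: measurable_int (intX _ _ (mA n)).
    by rewrite aliveS; exact: subIsetl.
  (* Since [alive X n] is in [F n], [Y] replaces [X n.+1]. On this event the indicator in the
     ranking inequality is 1, so it reads [Y <= X n - epsilon]. *)
  rewrite -YE// -integral_cst//.
  rewrite -(integralB (mA n) (intX n _ (mA n)) intc).
  apply: ae_le_integral => //.
  - exact: integrableS (measurableT) (mA n) _ intY.
  - exact: (integrableB (mA n) (intX n _ (mA n)) intc).
  - apply: filterS Yle => w + aw.
    by rewrite indicE mem_set ?mulr1 ?lee_fin//=; exact: aw.
(* The remainder integral is kept so that [descent] can absorb it at the next step. *)
have telescoped N : epsilon%:E * (\sum_(0 <= n < N) P (alive X n))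
      + \int[P]_(w in alive X N) (X N w)%:E <= 'E_P[X 0%N].
  elim: N => [|N IH].
    rewrite big_geq// mule0 add0e unlock.
    apply: ae_ge0_subset_integral => //.
      exact: measurable_int (intX 0%N _ measurableT).
    by case: (step 0%N) => _ + _; apply: filterS => w; rewrite lee_fin.
  apply: le_trans IH; rewrite big_nat_recr//= ge0_muleDr//; last first.
    by apply: sume_ge0.
  by rewrite -addeA leeD2l.
have time_le : \int[P]_w termination_time X w <= 'E_P[X 0%N] / epsilon%:E.
  (* Monotone convergence reduces the bound to partial sums; the remainder in [telescoped] is
     dropped, as [X N > 0] on [alive X N]. *)
  rewrite timeE integral_nneseries//.
  apply: lime_le; first by apply: is_cvg_nneseries => n _ _; exact: integral_ge0.
  near=> N; rewrite inver gt_eqF// lee_pdivlMr// muleC.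
  apply: le_trans (telescoped N).
  under eq_bigr do rewrite integral_indic// setIT.
  apply: leeDl; apply: integral_ge0 => w aw.
  by rewrite lee_fin ltW//; exact: aw.
split.
- rewrite inver gt_eqF// lee_pdivlMr// muleC.
  have mk : measurable [set w | k%:R%:E <= termination_time X w].
    by rewrite -[X in measurable X]setTI; exact: emeasurable_fun_c_infty.
  (* Markov: on the event, the constant [k] is at most the termination time, whose integral only
     grows on passing to the whole space. *)
  rewrite -integral_cst//.
  apply: (@le_trans _ _
      (\int[P]_(w in [set w | k%:R%:E <= termination_time X w])
        termination_time X w)).
    apply: ge0_le_integral => //; first by move=> w _; rewrite lee_fin ltW.
    exact: measurable_funS mtime.
  exact: ge0_subset_integral.
(* Positivity of [epsilon] and [k] excludes the zero case of [inver]; the claim is then [time_le]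
   divided by [k]. *)
- move: time_le; rewrite !inver !gt_eqF ?mulr_gt0// => time_le.
  by rewrite invfM EFinM muleA lee_wpmul2r// lee_fin.
Unshelve. all: by end_near. Qed.
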